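(* For every positive integer $n$, $$\sum_{k=0}^{n}\binom{n}{k}\left(2\sqrt{9y^2-t}\right)^{n-k}\left(2^{k+1}C_k(y,t)+2(6y)^k\right)G_{n-k}(x)=n2^{n+1}\sqrt{9y^2-t}\left(\left(3y+x\sqrt{9y^2-t}\right)^{n-1}+\left(3y+(x-1)\sqrt{9y^2-t}\right)^{n-1}\right).$$
   Context: Here $x,y,t$ are commuting variables (indeterminates) and $\sqrt{9y^2-t}$ denotes a fixed square root of $9y^2-t$ (in an extension field of the field of rational functions in $x,y,t$). The bivariate Lucas-balancing polynomials are defined by $C_0(y,t)=1$, $C_1(y,t)=3y$, $C_n(y,t)=6yC_{n-1}(y,t)-tC_{n-2}(y,t)$ for $n\ge 2$. The Genocchi polynomials $G_n(x)$ are defined by $\sum_{n\ge 0}G_n(x)\frac{z^n}{n!}=\frac{2ze^{xz}}{e^z+1}$. *)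

(* Defs.v *)
From HB Require Import structures.
From mathcomp Require Import all_boot all_order all_algebra.
From mathcomp Require Import fraction mpoly.

Set Implicit Arguments.
Unset Strict Implicit.
Unset Printing Implicit Defensive.

Import GRing.Theory.
Local Open Scope ring_scope.

(* A formal power series in z over R is represented by its coefficient
   sequence nat -> R; equality of series is pointwise equality. *)
Section PowerSeries.
Variable R : comUnitRingType.
Implicit Types (f g : nat -> R) (a : R).

Definition ps_mul f g : nat -> R :=
  fun n => \sum_(i < n.+1) f i * g (n - i)%N.

(* The first n coefficients of f / g, obtained by solving (f / g) * g = f
   coefficient by coefficient; meaningful when g 0 is a unit, cf. ps_divK. *)
Fixpoint ps_div_seq f g (n : nat) : seq R :=
  if n is m.+1 then
    let q := ps_div_seq f g m in
    rcons q ((f m - \sum_(i < m) q`_i * g (m - i)%N) / g 0%N)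
  else [::].

Definition ps_div f g : nat -> R := fun n => (ps_div_seq f g n.+1)`_n.

(* e^(a z); meaningful when the factorials are units of R, as in
   {mpoly F[m]} with F of characteristic 0, cf. mpoly_natU. *)
Definition ps_exp a : nat -> R := fun n => a ^+ n / n`!%:R.

Definition genocchi_num a : nat -> R :=
  fun n => if n is m.+1 then 2 * ps_exp a m else 0.

Definition genocchi_den : nat -> R := fun n => ps_exp 1 n + (n == 0%N)%:R.

(* G_n(a) = n! [z^n] (2 z e^(a z) / (e^z + 1)), cf. genocchi_gf. *)
Definition genocchi a (n : nat) : R :=
  n`!%:R * ps_div (genocchi_num a) genocchi_den n.

Fixpoint lucas_balancing (y t : R) (n : nat) : R :=
  match n with
  | 0 => 1
  | 1 => 3 * y
  | (m.+1 as p).+1 => 6 * y * lucas_balancing y t p - t * lucas_balancing y t m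
  end.

Lemma size_ps_div_seq f g n : size (ps_div_seq f g n) = n.
Proof. by elim: n => //= n IHn; rewrite size_rcons IHn. Qed.

Lemma nth_ps_div_seq f g n i :
  (i < n)%N -> (ps_div_seq f g n)`_i = ps_div f g i.
Proof.
elim: n => // n IHn; rewrite ltnS leq_eqVlt => /orP[/eqP -> //|lt_in].
by rewrite /= nth_rcons size_ps_div_seq lt_in IHn.
Qed.

Lemma ps_divK f g :
  g 0%N \is a GRing.unit -> ps_mul (ps_div f g) g =1 f.
Proof.
move=> g0U n; rewrite /ps_mul big_ord_recr /= subnn.
rewrite {2}/ps_div /= nth_rcons size_ps_div_seq ltnn eqxx mulrVK //.
rewrite addrC -addrA; apply/eqP; rewrite addrC -subr_eq0 addrK addrC subr_eq0.
by apply/eqP/eq_bigr => i _; rewrite nth_ps_div_seq.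
Qed.

Lemma genocchi_gf a :
    (forall n, n.+1%:R \is a @GRing.unit R) ->
  ps_mul (fun n => genocchi a n / n`!%:R) genocchi_den =1 genocchi_num a.
Proof.
move=> natU n; have factU m : m`!%:R \is a @GRing.unit R.
  by rewrite -(prednK (fact_gt0 m)).
rewrite -[RHS](@ps_divK _ genocchi_den); last first.
  by rewrite /genocchi_den /ps_exp expr0 fact0 divr1; apply: (natU 1%N).
apply: eq_bigr => i _.
by rewrite /genocchi [X in X / _]mulrC mulrK.
Qed.

End PowerSeries.

Lemma mpoly_natU (F : fieldType) (m n : nat) :
  [pchar F] =i pred0 -> n.+1%:R \is a @GRing.unit {mpoly F[m]}.
Proof.
move=> F0; rewrite -(rmorph_nat (@mpolyC m F)) rmorph_unit //.
by rewrite unitfE ((pcharf0P F).1 F0).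
Qed.

(* Main.v *)
Require Import Defs.
From HB Require Import structures.
From mathcomp Require Import all_boot all_order all_algebra.
From mathcomp Require Import fraction mpoly.
From mathcomp Require Import ring.

(** Write [w = 2 s], [alpha = 3 y + s], [beta = 3 y - s], so that
    [2 C_k = alpha^k + beta^k].  Let [Lambda] be the umbral functional
    [Z^m |-> G_m(x)]; the generating function of the Genocchi polynomials says
    that [Lambda (p(Z + 1) + p(Z)) = 2 p'(x)] for every polynomial [p].  With
    [p = (6 y + w Z)^n], the left-hand side of the identity is
    [Lambda (p(Z + 1) + p(Z - 1) + 2 p(Z))], i.e. [Lambda (q(Z + 1) + q(Z))]
    for [q(Z) = p(Z) + p(Z - 1)], and hence equals [2 q'(x)]. *)

Set Implicit Arguments.
Unset Strict Implicit.
Unset Printing Implicit Defensive.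

Import GRing.Theory.
Local Open Scope ring_scope.

Section Umbral.
Variables (R : comNzRingType) (g : nat -> R) (N : nat).
Implicit Types (p : {poly R}) (x a w : R).

(* Truncating at [N], rather than at [size p], makes linearity immediate. *)
Definition umbral p : R := \sum_(i < N) p`_i * g i.

Fact umbral_is_linear : linear_for *%R umbral.
Proof.
move=> c p q; rewrite /umbral mulr_sumr -big_split; apply: eq_bigr => i _.
by rewrite coefD coefZ mulrDl mulrA.
Qed.

HB.instance Definition _ :=
  GRing.isLinear.Build R {poly R} R *%R umbral umbral_is_linear.

Lemma umbralXn m : (m < N)%N -> umbral 'X^m = g m.
Proof.
move=> ltmN; rewrite /umbral (bigD1 (Ordinal ltmN)) //= coefXn eqxx mul1r.
rewrite big1 ?addr0 // => i; rewrite -val_eqE /= => /negbTE neq_im.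
by rewrite coefXn neq_im mul0r.
Qed.

Lemma umbral_exp_affine a w m : (m < N)%N ->
  umbral ((w *: 'X + a%:P) ^+ m)
    = \sum_(k < m.+1) 'C(m, k)%:R * w ^+ (m - k) * a ^+ k * g (m - k).
Proof.
move=> ltmN; rewrite exprDn raddf_sum; apply: eq_bigr => k _.
rewrite raddfMn /= exprZn -polyC_exp -scalerAl [_ * _%:P]mulrC mul_polyC.
rewrite !linearZ /= umbralXn ?(leq_ltn_trans (leq_subr _ _)) //.
by rewrite -mulr_natl; ring.
Qed.

Variable x : R.
(** The case [p = 'X^m] of [umbral_shiftD]. At [m = 0] the truncated exponent [m.-1] is harmless,
    since the factor [m%:R] vanishes. *)
Hypothesis g_rec : forall m, (m < N)%N ->
  \sum_(i < m.+1) 'C(m, i)%:R * g i + g m = 2 * m%:R * x ^+ m.-1.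

Lemma umbral_shiftD p : (size p <= N)%N ->
  umbral (p \Po ('X + 1)) + umbral p = 2 * p^`().[x].
Proof.
(* Writing [p] as a sum of monomials of exponent below [N] reduces the claim by linearity to
   [g_rec]. *)
move=> szp; rewrite -(take_poly_id szp) /take_poly poly_def.
rewrite !raddf_sum horner_sum mulr_sumr -big_split; apply: eq_bigr => i _.
rewrite /= linearZ /= comp_Xn_poly derivZ derivXn hornerZ hornerMn hornerXn.
rewrite !linearZ /= -mulrDr mulrCA; congr (_ * _).
rewrite umbralXn // -[_ *+ i]mulr_natl mulrA -g_rec //; congr (_ + _).
rewrite addrC exprDn raddf_sum; apply: eq_bigr => k _.
rewrite expr1n mul1r raddfMn /= umbralXn ?mulr_natl //.
exact: leq_ltn_trans (leq_ord k) _.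
Qed.

Lemma umbral_binomial_sum a w n : (n < N)%N ->
  \sum_(k < n.+1) 'C(n, k)%:R * w ^+ (n - k)
      * ((a + w) ^+ k + (a - w) ^+ k + 2 * a ^+ k) * g (n - k)
    = 2 * n%:R * w * ((a + w * x) ^+ n.-1 + (a + w * (x - 1)) ^+ n.-1).
Proof.
move=> ltnN; pose p b : {poly R} := (w *: 'X + b%:P) ^+ n.
have sz_p b : (size (p b) <= N)%N.
  apply: leq_trans (size_poly_exp_leq _ _) (leq_trans _ ltnN).
  rewrite ltnS -[leqRHS]mul1n leq_mul2r -subn1 leq_subLR addn1.
  rewrite (leq_trans (size_polyD _ _)) ?orbT // geq_max size_polyC.
  by rewrite (leq_trans (size_scale_leq _ _)) ?size_polyX //; case: eqP.
(* Translating the variable by 1 only moves the constant [b] by [w], so [p (a - w)] plays the role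
   of [p(Z - 1)]. *)
have shift_p b : p b \Po ('X + 1) = p (b + w).
  rewrite /p rmorphXn /= comp_polyD comp_polyZ comp_polyX comp_polyC.
  by rewrite scalerDr -addrA polyCD [in w *: 1]alg_polyC [w%:P + _]addrC.
have deriv_p b : (p b)^`().[x] = n%:R * w * (b + w * x) ^+ n.-1.
  rewrite deriv_exp derivD derivZ derivX derivC addr0 hornerMn hornerM horner_exp.
  by rewrite !hornerE -mulr_natl mulrA [w * x + b]addrC.
have := umbral_shiftD (sz_p a); have := umbral_shiftD (sz_p (a - w)).
rewrite !shift_p !deriv_p subrK => shift_aw shift_a.
transitivity (umbral (p (a + w)) + umbral (p (a - w)) + 2 * umbral (p a)).
  rewrite !umbral_exp_affine // mulr_sumr -!big_split.
  by apply: eq_bigr => k _ /=; ring.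
have -> : a + w * (x - 1) = a - w + w * x by ring.
rewrite [RHS](_ : _ = 2 * (n%:R * w * (a + w * x) ^+ n.-1)
    + 2 * (n%:R * w * (a - w + w * x) ^+ n.-1)); last by ring.
by rewrite -shift_a -shift_aw; ring.
Qed.

End Umbral.

(** Compare coefficients of [z^n] in [G(z) (e^z + 1) = 2 z e^(a z)] and multiply by [n!]. *)
Lemma genocchi_rec (R : comUnitRingType) (a : R) (n : nat) :
    (forall m, m.+1%:R \is a @GRing.unit R) ->
  \sum_(i < n.+1) 'C(n, i)%:R * genocchi a i + genocchi a n
    = 2 * n%:R * a ^+ n.-1.
Proof.
move=> natU; have factU m : m`!%:R \is a @GRing.unit R.
  by rewrite -(prednK (fact_gt0 m)).
have := genocchi_gf a natU n; rewrite /ps_mul => /(congr1 ( *%R n`!%:R)).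
have -> : n`!%:R * genocchi_num a n = 2 * n%:R * a ^+ n.-1.
  case: n => [|n] /=; first by rewrite !(mulr0, mul0r).
  rewrite /ps_exp factS natrM.
  by rewrite -[a ^+ n in RHS](divrK (factU n)); ring.
move=> <-; rewrite mulr_sumr /genocchi_den /ps_exp.
under [RHS]eq_bigr => i _ do rewrite expr1n mulrDr mulrDr.
(* The factor [e^z] yields the binomial sum; the summand 1 of the denominator keeps only the term
   [i = n]. *)
rewrite big_split /=; congr (_ + _).
  apply: eq_bigr => i _; rewrite -(bin_fact (leq_ord i)) !natrM.
  transitivity ('C(n, i)%:R * genocchi a i * (i`!%:R / i`!%:R)
      * ((n - i)`!%:R / (n - i)`!%:R)).
    by rewrite !divrr // !mulr1.
  by ring.
rewrite big_ord_recr /= subnn eqxx mulr1 [n`!%:R * _]mulrC divrK // big1 ?add0r // => i _.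
by rewrite subn_eq0 leqNgt ltn_ord !mulr0.
Qed.

Lemma lucas_balancingSS (R : comUnitRingType) (y t : R) (k : nat) :
  lucas_balancing y t k.+2
    = 6 * y * lucas_balancing y t k.+1 - t * lucas_balancing y t k.
Proof. by []. Qed.

(** Both [3 * y + s] and [3 * y - s] are roots of [T^2 - 6 y T + t], so their powers satisfy the
    recurrence of [lucas_balancing]. *)
Lemma lucas_balancing_binet (R : comUnitRingType) (y t s : R) (k : nat) :
  s ^+ 2 = 9 * y ^+ 2 - t ->
  2 * lucas_balancing y t k = (3 * y + s) ^+ k + (3 * y - s) ^+ k.
Proof.
move=> s2; have -> : t = 9 * y ^+ 2 - s ^+ 2 by rewrite s2; ring.
elim/ltn_ind: k => -[|[|k]] IHk; [by rewrite /=; ring.. | ].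
by rewrite lucas_balancingSS mulrBr 2![2 * (_ * _)]mulrCA !IHk // !exprS; ring.
Qed.

Lemma rmorph_lucas_balancing (R S : comUnitRingType) (f : {rmorphism R -> S})
    (y t : R) (k : nat) :
  f (lucas_balancing y t k) = lucas_balancing (f y) (f t) k.
Proof.
elim/ltn_ind: k => -[|[|k]] IHk; first exact: rmorph1.
  by rewrite /= rmorphM rmorph_nat.
by rewrite !lucas_balancingSS rmorphB !rmorphM rmorph_nat -!IHk.
Qed.

(** The Genocchi polynomials live in [R], the square root [s] in [S]; the Genocchi recurrence is
    proved in [R] and carried over by [f]. *)
Lemma genocchi_lucas_balancing_sum (R S : comUnitRingType)
    (f : {rmorphism R -> S}) (x y t : R) (s : S) (n : nat) :
    (forall m, m.+1%:R \is a @GRing.unit R) ->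
    s ^+ 2 = f (9 * y ^+ 2 - t) ->
  \sum_(k < n.+2)
     'C(n.+1, k)%:R * (2 * s) ^+ (n.+1 - k)
       * f (2 ^+ k.+1 * lucas_balancing y t k + 2 * (6 * y) ^+ k)
       * f (genocchi x (n.+1 - k))
  = n.+1%:R * 2 ^+ n.+2 * s
      * ((3 * f y + f x * s) ^+ n + (3 * f y + (f x - 1) * s) ^+ n).
Proof.
move=> natU s2; pose g i := f (genocchi x i).
have g_rec m : (m < n.+2)%N ->
  \sum_(i < m.+1) 'C(m, i)%:R * g i + g m = 2 * m%:R * f x ^+ m.-1.
  move=> _; have := genocchi_rec x m natU.
  move=> /(congr1 f); rewrite rmorphD [f (2 * _ * _)]rmorphM rmorphM !rmorph_nat rmorphXn => <-.
  rewrite rmorph_sum; congr (_ + _); apply: eq_bigr => i _.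
  by rewrite rmorphM rmorph_nat.
(* This is [umbral_binomial_sum] at [a = 6 * f y], [w = 2 * s]. Then [a + w] and [a - w] are twice
   the Binet roots, so the sum of their [k]-th powers is [2 ^+ k.+1] times the Lucas-balancing
   value. *)
transitivity (2 * n.+1%:R * (2 * s) * ((6 * f y + 2 * s * f x) ^+ n
    + (6 * f y + 2 * s * (f x - 1)) ^+ n)).
  rewrite -(umbral_binomial_sum g_rec _ _ (ltnSn _)); apply: eq_bigr => k _.
  rewrite /g; congr (_ * _ * _).
  have -> : 6 * f y + 2 * s = 2 * (3 * f y + s) by ring.
  have -> : 6 * f y - 2 * s = 2 * (3 * f y - s) by ring.
  rewrite rmorphD !rmorphM !rmorphXn rmorphM !rmorph_nat rmorph_lucas_balancing.
  rewrite !exprMn -mulrDr -(@lucas_balancing_binet _ _ (f t)).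
    by rewrite exprS; ring.
  by rewrite s2 rmorphB rmorphM rmorphXn rmorph_nat.
(* Each [n]-th power releases [2 ^+ n], which with the two factors 2 in front makes [2 ^+ n.+2]. *)
have -> : 6 * f y + 2 * s * f x = 2 * (3 * f y + f x * s) by ring.
have -> : 6 * f y + 2 * s * (f x - 1) = 2 * (3 * f y + (f x - 1) * s) by ring.
by rewrite !exprMn !exprS /=; ring.
Qed.

Theorem corollary22 (F : fieldType) (F0 : [pchar F] =i pred0)
    (L : fieldType) (iota : {rmorphism {fraction {mpoly F[3]}} -> L}) :
  let x : {mpoly F[3]} := 'X_(inord 0) in
  let y : {mpoly F[3]} := 'X_(inord 1) in
  let t : {mpoly F[3]} := 'X_(inord 2) in
  let emb (p : {mpoly F[3]}) : L := iota (tofrac p) in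
  forall s : L, s ^+ 2 = emb (9 * y ^+ 2 - t) ->
  forall n : nat, (0 < n)%N ->
  \sum_(0 <= k < n.+1)
     'C(n, k)%:R * (2 * s) ^+ (n - k)
       * emb (2 ^+ k.+1 * lucas_balancing y t k + 2 * (6 * y) ^+ k)
       * emb (genocchi x (n - k))
  = n%:R * 2 ^+ n.+1 * s
      * ((3 * emb y + emb x * s) ^+ n.-1
         + (3 * emb y + (emb x - 1) * s) ^+ n.-1).
Proof.
move=> x y t emb s s2 [//|n] _; rewrite big_mkord.
have natU k : k.+1%:R \is a @GRing.unit {mpoly F[3]} by exact: mpoly_natU.
exact: (@genocchi_lucas_balancing_sum _ L (iota \o @tofrac _)).
Qed.
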